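(* Let $q \ge 2$ be a fixed integer and let $\theta \le 1/2$ be such that $$\frac{1}{2}\log(1-2\theta) + (1-\theta)\log\left(\frac{1-\theta}{1-2\theta}\right) + \theta\log 2 - (1-2\theta)\log q > 0.$$ Then for all $n$ large enough, whenever a $k$-uniform state in $(\mathbb{C}^q)^{\otimes n}$ exists, we have $k \le \theta n$.
   Context: $\log$ denotes the natural logarithm. A pure state $|\psi\rangle \in (\mathbb{C}^q)^{\otimes n}$ is called $k$-uniform if, with $\rho = |\psi\rangle\langle\psi|$, for every subset $S \subseteq \{1,\dots,n\}$ with $|S| = k$ the reduced state of $\rho$ on the parties in $S$ equals $I/q^k$, where $I$ is the identity on $(\mathbb{C}^q)^{\otimes k}$. *)

(* Defs.v *)
From HB Require Import structures.
From mathcomp Require Import all_boot all_order all_algebra.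
From mathcomp Require Import complex.
From mathcomp Require Import all_classical all_reals all_analysis.
Set Implicit Arguments. Unset Strict Implicit. Unset Printing Implicit Defensive.
Import Order.TTheory GRing.Theory Num.Theory.
Local Open Scope ring_scope.
Local Open Scope complex_scope.

(* Computational basis of (C^q)^{\otimes n}: strings x : 'I_n -> 'I_q.
   A vector psi in (C^q)^{\otimes n} is its coefficient function. *)
Definition basis_idx (n q : nat) := {ffun 'I_n -> 'I_q}.

Definition merge (n q : nat) (S : {set 'I_n}) (y z : {ffun 'I_n -> 'I_q})
  : {ffun 'I_n -> 'I_q} := [ffun i => if i \in S then y i else z i].

Definition is_pure_state (R : rcfType) (n q : nat)
  (psi : {ffun 'I_n -> 'I_q} -> R[i]) : Prop :=
  \sum_(z : {ffun 'I_n -> 'I_q}) psi z * (psi z)^* = 1.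

(* Matrix entry <x_S| rho_S |y_S> of the reduced state on S of
   rho = |psi><psi|, i.e. partial trace over the complement of S;
   only the values of x, y on S matter. *)
Definition reduced_entry (R : rcfType) (n q : nat)
  (psi : {ffun 'I_n -> 'I_q} -> R[i]) (S : {set 'I_n})
  (x y : {ffun 'I_n -> 'I_q}) : R[i] :=
  \sum_(z : {ffun 'I_n -> 'I_q} | [forall i in S, z i == x i])
     psi z * (psi (merge S y z))^*.

Definition k_uniform (R : rcfType) (n q : nat) (k : nat)
  (psi : {ffun 'I_n -> 'I_q} -> R[i]) : Prop :=
  is_pure_state psi /\
  forall S : {set 'I_n}, #|S| = k ->
    forall x y : {ffun 'I_n -> 'I_q},
      reduced_entry psi S x y =
        (if [forall i in S, x i == y i] then (q ^ k)%:R^-1 else 0).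

(* Main.v *)
(* This is the Plotkin bound for quantum codes; it is stronger than the stated
   rate condition.  For a set S of parties put t(S) = q^|S| tr (rho_S^2).
   Expanding rho into its components supported exactly on T gives
   t(S) = sum of a(T) over T included in S, with a(T) >= 0 and a(empty) = 1, and
   k-uniformity forces a(T) = 0 for 1 <= |T| <= k.  Purity of the state gives
   q^|S^c| t(S) = q^|S| t(S^c), whence t(S) >= q^(2|S| - n) and
   t(S) <= q^2 t(S minus a point).  Averaging |T| against a(T) over the subsets
   T of S then yields
     (k + 1) (t(S) - 1) <= |S| (1 - 1/q^2) t(S).
   With |S| = n/2 + O(1) this gives k <= (1 - 1/q^2) n/2 + o(n), while the rate
   condition implies theta > (1 - 1/q^2) / 2. *)
Require Import Defs.
From HB Require Import structures.
From mathcomp Require Import all_boot all_order all_algebra.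
From mathcomp Require Import complex.
From mathcomp Require Import all_classical all_reals all_analysis.
From mathcomp Require Import ring lra zify.
From mathcomp Require Import fintype finset.
Import Defs.
Set Implicit Arguments. Unset Strict Implicit. Unset Printing Implicit Defensive.
Import Order.TTheory GRing.Theory Num.Theory.
Local Open Scope ring_scope.

(** * Subset sums of nonnegative weights and Plotkin averaging *)

Definition downsum (F : numFieldType) (I : finType) (a : {set I} -> F)
  (S : {set I}) : F := \sum_(T : {set I} | T \subset S) a T.

(** Double counting: deleting [i] loses exactly the sets [T] that contain [i], so each [T] is lost
    once per element. *)
Lemma sum_downsum_delete (F : numFieldType) (I : finType) (a : {set I} -> F)
    (S : {set I}) :
  \sum_(i in S) (downsum a S - downsum a (S :\ i)) =
  \sum_(T : {set I} | T \subset S) a T *+ #|T|.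
Proof.
have del i : downsum a S - downsum a (S :\ i) =
             \sum_(T : {set I} | (T \subset S) && (i \in T)) a T.
  rewrite /downsum (bigID (fun T : {set I} => i \in T)) /=.
  rewrite [X in _ - X](eq_bigl (fun T : {set I} => (T \subset S) && (i \notin T))).
    by rewrite addrK.
  by move=> T; rewrite subsetD1.
under eq_bigr do rewrite del.
rewrite (exchange_big_dep (fun T : {set I} => T \subset S)) /=; last first.
  by move=> i T _ /andP[].
apply: eq_bigr => T sTS; rewrite sumr_const; congr (_ *+ _).
by apply: eq_card => i; rewrite unfold_in /= sTS /=; apply/andb_idl/subsetP.
Qed.

Lemma downsum_le (F : numFieldType) (I : finType) (a : {set I} -> F)
    (S T : {set I}) :
  (forall U, 0 <= a U) -> S \subset T -> downsum a S <= downsum a T.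
Proof.
move=> a_ge0 sST.
rewrite /downsum [leRHS](bigID (fun U : {set I} => U \subset S)) /=.
rewrite [X in _ <= X + _](eq_bigl (fun U : {set I} => U \subset S)).
  by rewrite lerDl sumr_ge0.
by move=> U; apply: andb_idl => /subset_trans; apply.
Qed.

Lemma downsum_set0 (F : numFieldType) (I : finType) (a : {set I} -> F) :
  downsum a set0 = a set0.
Proof.
by rewrite /downsum (big_pred1 set0) // => T; rewrite subset0.
Qed.

(** Enlarge [T] to a set [S] of size [k]: the empty set already uses up the total 1, so all other
    nonnegative terms below [S] are zero. *)
Lemma vanish_of_downsum (F : numFieldType) (I : finType) (a : {set I} -> F)
    (k : nat) :
  (forall U, 0 <= a U) -> (k <= #|I|)%N -> a set0 = 1 ->
  (forall S : {set I}, #|S| = k -> downsum a S = 1) ->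
  forall T : {set I}, (0 < #|T| <= k)%N -> a T = 0.
Proof.
move=> a_ge0 kI a0 dsk T /andP[T_gt0 Tk].
have [S sTS Sk] : exists2 S : {set I}, T \subset S & #|S| = k.
  have : (k - #|T| <= #|~: T|)%N by have := cardsC T; lia.
  case/card_geqP => s [s_uniq s_size sT].
  exists (T :|: [set x in s]); first exact: subsetUl.
  rewrite cardsU disjoint_setI0 ?cards0 ?subn0.
    by rewrite cardsE (card_uniqP s_uniq) s_size; lia.
  rewrite disjoint_sym disjoints_subset; apply/subsetP => x; rewrite inE.
  exact: sT.
have := dsk S Sk; rewrite /downsum (bigD1 set0) ?sub0set //= a0 => /eqP.
rewrite -subr_eq0 addrAC subrr add0r psumr_eq0 // => /allP/(_ T).
rewrite mem_index_enum sTS -cards_eq0 -lt0n T_gt0 /= => /(_ isT).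
by move/eqP.
Qed.

(* Plotkin's argument: a nonempty set of positive weight has more than k elements,
   whereas deleting an element loses at most the fraction 1 - 1/q^2. *)
Lemma plotkin_bound (F : numFieldType) (I : finType) (a : {set I} -> F)
    (q k : nat) :
  (0 < q)%N -> (k <= #|I|)%N ->
  (forall U, 0 <= a U) -> a set0 = 1 ->
  (forall S : {set I}, #|S| = k -> downsum a S = 1) ->
  (forall S : {set I}, (q ^ #|~: S|)%:R * downsum a S =
                       (q ^ #|S|)%:R * downsum a (~: S)) ->
  forall s : nat, (#|I| <= s.*2)%N -> (s <= #|I|)%N ->
  (q ^ (s.*2 - #|I|) * (q ^ 2 * k.+1 - s * (q ^ 2 - 1)) <= q ^ 2 * k.+1)%N.
Proof.
move=> q_gt0 kI a_ge0 a0 dsk dual s Is sI.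
have [S Ss] : exists S : {set I}, #|S| = s.
  have : (s <= #|[set: I]|)%N by rewrite cardsT.
  case/card_geqP => l [l_uniq l_size _].
  by exists [set x in l]; rewrite cardsE (card_uniqP l_uniq).
have qX_neq0 m : (q ^ m)%:R != 0 :> F by rewrite pnatr_eq0 -lt0n expn_gt0 q_gt0.
have qX_gt0 m : 0 < (q ^ m)%:R :> F by rewrite ltr0n expn_gt0 q_gt0.
have SC : (#|~: S| = #|I| - s)%N by rewrite cardsCs setCK Ss.
have ds_ge1 U : 1 <= downsum a U.
  by rewrite -a0 -downsum_set0 downsum_le ?sub0set.
have tau_ge : (q ^ (s.*2 - #|I|))%:R <= downsum a S.
  have -> : downsum a S = (q ^ (s.*2 - #|I|))%:R * downsum a (~: S).
    apply: (mulfI (qX_neq0 (#|I| - s)%N)); rewrite -SC dual SC Ss mulrA -natrM.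
    by rewrite -expnD; congr ((q ^ _)%:R * _); lia.
  by rewrite ler_peMr.
(* Duality turns deletion from [S] into enlargement of the complement, which cannot lower [downsum];
   the two shifted exponents give [q ^ 2]. *)
have delete_ge i : i \in S ->
    downsum a S <= (q ^ 2)%:R * downsum a (S :\ i).
  move=> iS; have cD : #|S :\ i| = s.-1 by have := cardsD1 i S; rewrite iS; lia.
  have s_gt0 : (0 < s)%N by rewrite -Ss; apply/card_gt0P; exists i.
  have cDC : #|~: (S :\ i)| = (#|I| - s).+1 by rewrite cardsCs setCK cD; lia.
  rewrite -(ler_pM2l (qX_gt0 (#|I| - s).+1)) mulrCA -{2}cDC dual cD.
  rewrite expnS natrM -mulrA -SC dual Ss.
  rewrite !mulrA -!natrM mulnC -expnSr -expnD.
  have -> : (2 + s.-1 = s.+1)%N by lia.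
  rewrite ler_pM2l // downsum_le // setCS.
  exact: subD1set.
have weight_ge : k.+1%:R * (downsum a S - 1) <=
    \sum_(T : {set I} | T \subset S) a T *+ #|T|.
  rewrite /downsum (bigD1 set0) ?sub0set //= a0 addrC addrK.
  rewrite [leRHS](bigD1 set0) ?sub0set //= cards0 mulr0n add0r mulr_sumr.
  apply: ler_sum => T /andP[_ T0]; rewrite -[leRHS]mulr_natl.
  have [Tk|Tk] := leqP #|T| k.
    by rewrite (@vanish_of_downsum _ _ a k) ?mulr0 // Tk card_gt0 T0.
  by rewrite ler_wpM2r ?ler_nat.
have key : (q ^ 2)%:R * (k.+1%:R * (downsum a S - 1)) <=
           s%:R * ((q ^ 2)%:R * downsum a S - downsum a S).
  apply: le_trans (ler_wpM2l (ltW (qX_gt0 2%N)) weight_ge) _.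
  rewrite -sum_downsum_delete mulr_sumr mulr_natl -Ss -sumr_const.
  by apply: ler_sum => i iS; rewrite mulrBr lerB // delete_ge.
(* If the truncated difference is 0 the claim is trivial; otherwise it is a true difference in
   [F]. *)
have [small|/ltnW big] := leqP (q ^ 2 * k.+1) (s * (q ^ 2 - 1)).
  by rewrite (eqP (small : _ - _ == 0)%N) muln0.
rewrite -(ler_nat F) natrM natrB // (natrM _ (q ^ 2)%N) (natrM _ s)
  natrB ?expn_gt0 ?q_gt0 //.
set Q : F := (q ^ 2)%:R in key *; set t := downsum a S in key tau_ge *.
set c : F := Q * _ - _.
have c_ge0 : 0 <= c.
  have eQ : Q - 1 = (q ^ 2 - 1)%:R by rewrite natrB ?expn_gt0 ?q_gt0.
  by rewrite subr_ge0 eQ -!natrM ler_nat.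
apply: le_trans (ler_wpM2r c_ge0 tau_ge) _.
rewrite -subr_ge0; move: key; rewrite -subr_ge0 /c.
by congr (_ <= _); ring.
Qed.

(** * Rearranging sums and expanding products *)

Lemma exchange_big2 (V : nmodType) (I J K L : finType)
    (F : I -> J -> K -> L -> V) :
  \sum_i \sum_j \sum_k \sum_l F i j k l = \sum_k \sum_l \sum_i \sum_j F i j k l.
Proof.
transitivity (\sum_i \sum_k \sum_l \sum_j F i j k l).
  apply: eq_bigr => i _; rewrite exchange_big.
  by apply: eq_bigr => k _; rewrite exchange_big.
by rewrite exchange_big; apply: eq_bigr => k _; rewrite exchange_big.
Qed.

(** Distributivity, with [A] replaced by 0 outside [S] so that only subsets of [S] contribute. *)
Lemma sum_prod_subset (F : comNzRingType) (I : finType) (S : {set I})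
    (A E : I -> F) :
  \sum_(T : {set I} | T \subset S) \prod_i (if i \in T then A i else E i) =
  \prod_i (if i \in S then A i + E i else E i).
Proof.
transitivity (\prod_i ((if i \in S then A i else 0) + E i)); last first.
  by apply: eq_bigr => i _; case: ifP; rewrite ?add0r.
rewrite bigA_distr [RHS](bigID (fun T : {set I} => T \subset S)) /=.
rewrite [X in _ = _ + X]big1 ?addr0; last first.
  move=> T /subsetPn[i iT iS].
  by rewrite (bigD1 i) //= iT (negbTE iS) mul0r.
apply: eq_bigr => T sTS; apply: eq_bigr => i _.
by case: ifP => // /(subsetP sTS)->.
Qed.

(** * Purity of reduced states *)

Section Purity.
Variables (R : rcfType) (n q : nat) (psi : {ffun 'I_n -> 'I_q} -> R[i]).
Local Notation B := {ffun 'I_n -> 'I_q}.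

(* [tr (rho_S ^ 2)], written as the expectation of the operator on two copies
   of the state that exchanges their S-parts. *)
Definition purity (S : {set 'I_n}) : R[i] :=
  \sum_(x : B) \sum_(y : B)
    psi x * psi y * (psi (merge S y x) * psi (merge S x y))^*.

Lemma merge_setC (S : {set 'I_n}) (x y : B) : merge (~: S) x y = merge S y x.
Proof. by apply/ffunP => i; rewrite !ffunE inE; case: (i \in S). Qed.

(** Exchanging the complementary parts of two strings yields the same two strings in the other
    order. *)
Lemma purity_setC (S : {set 'I_n}) : purity (~: S) = purity S.
Proof.
apply: eq_bigr => x _; apply: eq_bigr => y _.
by rewrite !merge_setC [X in _ * X^*]mulrC.
Qed.

Lemma purity_set0 : is_pure_state psi -> purity set0 = 1.
Proof.
move=> psi1; rewrite -[RHS]mulr1 -[in RHS]psi1 mulr_suml.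
apply: eq_bigr => x _; rewrite mulr_sumr; apply: eq_bigr => y _.
have merge0 (u v : B) : merge set0 u v = v.
  by apply/ffunP => i; rewrite ffunE inE.
by rewrite !merge0 rmorphM /=; ring.
Qed.

(** Grouping the strings [x] by [u = merge S x y] makes each inner sum a reduced entry; only the
    diagonal one survives, leaving the squared norm of [psi]. *)
Lemma purity_k_uniform (k : nat) (S : {set 'I_n}) :
  k_uniform k psi -> #|S| = k -> purity S = (q ^ k)%:R^-1.
Proof.
move=> [psi1 unif] Sk; rewrite /purity exchange_big /=.
rewrite -[RHS]mulr1 -[X in _ * X]psi1 mulr_sumr; apply: eq_bigr => y _.
rewrite (partition_big (fun x => merge S x y)
  (fun u : B => [forall i in ~: S, u i == y i])) /=; last first.
  by move=> x _; apply/forall_inP => i; rewrite inE !ffunE => /negbTE->.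
transitivity (\sum_(u : B | [forall i in ~: S, u i == y i])
   reduced_entry psi S u y * (psi y * (psi u)^*)).
  apply: eq_bigr => u /forall_inP uy; rewrite /reduced_entry mulr_suml.
  rewrite (eq_bigl (fun z : B => [forall i in S, z i == u i])); last first.
    move=> x; apply/eqP/forall_inP => [<- i iS|xu]; first by rewrite ffunE iS.
    apply/ffunP => i; rewrite ffunE; case: ifP => [/xu/eqP//|iS].
    by apply/esym/eqP/uy; rewrite inE iS.
  apply: eq_bigr => x /forall_inP xu.
  have -> : merge S x y = u.
    apply/ffunP => i; rewrite ffunE; case: ifP => [/xu/eqP//|iS].
    by apply/esym/eqP/uy; rewrite inE iS.
  by rewrite rmorphM /=; ring.
rewrite (bigD1 y) /=; last by apply/forall_inP.
rewrite unif // ifT ?Sk; last by apply/forall_inP.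
(* Such a [u] agrees with [y] off [S], so it differs from [y] on [S] and its entry is
   off-diagonal. *)
rewrite big1 ?addr0 // => u /andP[/forall_inP uy uNy].
rewrite unif // ifF ?mul0r //; apply: contraNF uNy => /forall_inP uyS.
apply/eqP/ffunP => i; apply/eqP; case: (boolP (i \in S)) => iS; first exact: uyS.
by apply: uy; rewrite inE.
Qed.

(** * One-site projections and support weights *)

Definition trace_kernel (a b c d : 'I_q) : R[i] :=
  ((a == b) && (c == d))%:R.

(** Summed against [X a b * (Y c d)^*], this gives the Hilbert-Schmidt inner product of [X] and [Y],
    while [trace_kernel] gives tr X times the conjugate of tr Y. *)
Definition id_kernel (a b c d : 'I_q) : R[i] := ((a == c) && (b == d))%:R.

(* q times the orthogonal projection of a one-site matrix onto its trace-free
   part (b = true) or onto the multiples of the identity (b = false). *)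
Definition proj_kernel (b : bool) (x y x' y' : 'I_q) : R[i] :=
  if b then q%:R * id_kernel x y x' y' - trace_kernel x y x' y'
  else trace_kernel x y x' y'.

Lemma sum_id_kernel (f : 'I_q -> 'I_q -> R[i]) x y :
  \sum_a \sum_b id_kernel a b x y * f a b = f x y.
Proof.
rewrite (bigD1 x) //= (bigD1 y) //= /id_kernel !eqxx mul1r.
rewrite [X in _ + X + _]big1 ?addr0 => [|b /negbTE by_]; last first.
  by rewrite by_ andbF mul0r.
rewrite big1 ?addr0 // => a /negbTE ax; rewrite big1 // => b _.
by rewrite ax mul0r.
Qed.

Lemma sum_trace_kernel (f : 'I_q -> 'I_q -> R[i]) x y :
  \sum_a \sum_b trace_kernel a b x y * f a b = (x == y)%:R * \sum_a f a a.
Proof.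
rewrite mulr_sumr; apply: eq_bigr => a _; rewrite (bigD1 a) //= big1 ?addr0.
  by rewrite /trace_kernel eqxx.
by move=> b; rewrite eq_sym /trace_kernel => /negbTE->; rewrite mul0r.
Qed.

(** The kernel is q P with P a symmetric projection, and (q P)^2 = q (q P). *)
Lemma proj_kernel_square b x y x' y' :
  \sum_(u : 'I_q) \sum_(v : 'I_q)
     proj_kernel b u v x y * proj_kernel b u v x' y' =
  q%:R * proj_kernel b x y x' y'.
Proof.
have tt : \sum_(a : 'I_q) trace_kernel a a x' y' = q%:R * (x' == y')%:R.
  rewrite /trace_kernel (eq_bigr (fun=> (x' == y')%:R)); last first.
    by move=> a; rewrite eqxx.
  by rewrite sumr_const card_ord mulr_natl.
have ti : \sum_(a : 'I_q) id_kernel a a x' y' = (x' == y')%:R.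
  rewrite (eq_bigr (fun a => (a == x')%:R * (x' == y')%:R)) => [|a _].
    by rewrite -mulr_suml (bigD1 x') //= eqxx big1 ?addr0 ?mul1r // => a /negbTE->.
  by rewrite /id_kernel -natrM mulnb; case: eqP => // ->.
case: b; rewrite /proj_kernel; last first.
  by rewrite sum_trace_kernel tt mulrCA -natrM mulnb.
under eq_bigr do under eq_bigr do rewrite mulrBl -mulrA.
under eq_bigr do rewrite sumrB -mulr_sumr.
rewrite sumrB -mulr_sumr sum_id_kernel sum_trace_kernel sumrB -mulr_sumr ti tt.
by rewrite subrr mulr0 subr0.
Qed.

Lemma sum_prod_pairs (f : 'I_n -> 'I_q -> 'I_q -> R[i]) :
  \sum_(u : B) \sum_(v : B) \prod_i f i (u i) (v i) =
  \prod_i \sum_a \sum_b f i a b.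
Proof.
by rewrite bigA_distr_bigA; apply: eq_bigr => u _; rewrite bigA_distr_bigA.
Qed.

(* q^n times the squared Hilbert-Schmidt norm of the component of the density
   matrix that is trace-free exactly at the sites of T. *)
Definition support_weight (T : {set 'I_n}) : R[i] :=
  \sum_(x : B) \sum_(y : B) \sum_(x' : B) \sum_(y' : B)
    psi x * (psi y)^* * (psi x' * (psi y')^*)^* *
    \prod_i proj_kernel (i \in T) (x i) (y i) (x' i) (y' i).

Lemma conj_proj_kernel b x y x' y' :
  (proj_kernel b x y x' y')^* = proj_kernel b x y x' y'.
Proof.
by rewrite /proj_kernel; case: b; rewrite ?rmorphB ?rmorphM /= !conjC_nat.
Qed.

(** By [proj_kernel_square] at every site, [q ^ n] times the weight is a sum of squared moduli. *)
Lemma support_weight_ge0 (T : {set 'I_n}) :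
  (0 < q)%N -> 0 <= support_weight T.
Proof.
move=> q_gt0.
pose K (u v x y : B) := \prod_i proj_kernel (i \in T) (u i) (v i) (x i) (y i).
(* The [u], [v] entry of [q ^ n] times the component of the density matrix selected by [T]. *)
pose comp u v := \sum_(x : B) \sum_(y : B) K u v x y * (psi x * (psi y)^*).
have conjK u v x y : (K u v x y)^* = K u v x y.
  by rewrite /K rmorph_prod; apply: eq_bigr => i _; exact: conj_proj_kernel.
have qn_gt0 : 0 < (q ^ n)%:R :> R[i] by rewrite ltr0n expn_gt0 q_gt0.
rewrite -(pmulr_rge0 _ qn_gt0).
suff -> : (q ^ n)%:R * support_weight T =
          \sum_(u : B) \sum_(v : B) comp u v * (comp u v)^*.
  by do 2![apply: sumr_ge0 => ? _]; exact: mul_conjC_ge0.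
have square (x y x' y' : B) :
    (q ^ n)%:R * \prod_i proj_kernel (i \in T) (x i) (y i) (x' i) (y' i) =
    \sum_(u : B) \sum_(v : B) K u v x y * K u v x' y'.
  under [RHS]eq_bigr do under eq_bigr do rewrite -big_split /=.
  rewrite (sum_prod_pairs (fun i a b => proj_kernel (i \in T) a b (x i) (y i) *
    proj_kernel (i \in T) a b (x' i) (y' i))).
  under [RHS]eq_bigr do rewrite proj_kernel_square.
  by rewrite big_split /= prodr_const card_ord natrX.
rewrite /support_weight mulr_sumr.
under eq_bigr do rewrite mulr_sumr.
under eq_bigr do under eq_bigr do rewrite mulr_sumr.
under eq_bigr do under eq_bigr do under eq_bigr do rewrite mulr_sumr.
transitivity (\sum_(x : B) \sum_(y : B) \sum_(x' : B) \sum_(y' : B)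
    \sum_(u : B) \sum_(v : B) K u v x y * (psi x * (psi y)^*) *
      (K u v x' y' * (psi x' * (psi y')^*))^*).
  apply: eq_bigr => x _; apply: eq_bigr => y _.
  apply: eq_bigr => x' _; apply: eq_bigr => y' _.
  rewrite mulrCA square mulr_sumr; apply: eq_bigr => u _.
  rewrite mulr_sumr; apply: eq_bigr => v _.
  by rewrite [X in _ = _ * X]rmorphM /= conjK; ring.
under eq_bigr do under eq_bigr do rewrite exchange_big2.
rewrite exchange_big2; apply: eq_bigr => u _; apply: eq_bigr => v _.
rewrite /comp rmorph_sum mulr_suml; apply: eq_bigr => x _.
rewrite mulr_suml; apply: eq_bigr => y _.
rewrite mulr_sumr; apply: eq_bigr => x' _.
by rewrite rmorph_sum mulr_sumr.
Qed.

(** The sitewise equalities determine [y] and [x'] from [x] and [y']: this is the kernel of the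
    operator exchanging S-parts. *)
Lemma prod_swap_kernel (S : {set 'I_n}) (x y x' y' : B) :
  \prod_i (if i \in S then q%:R * id_kernel (x i) (y i) (x' i) (y' i)
           else trace_kernel (x i) (y i) (x' i) (y' i)) =
  (q ^ #|S|)%:R * ((y == merge S y' x)%:R * (x' == merge S x y')%:R).
Proof.
pose b i := if i \in S then (x i == x' i) && (y i == y' i)
            else (x i == y i) && (x' i == y' i).
transitivity (\prod_i ((if i \in S then q%:R else 1) * (b i)%:R : R[i])).
  by apply: eq_bigr => i _; rewrite /b; case: (i \in S); rewrite ?mul1r.
rewrite big_split /= -big_mkcond /= prodr_const natrX -natrM mulnb.
congr (_ * _); have -> : (y == merge S y' x) && (x' == merge S x y') = [forall i, b i].
  apply/andP/forallP => [[/eqP yE /eqP xE] i|bP].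
    by rewrite /b yE xE !ffunE; case: (i \in S); rewrite !eqxx.
  by split; apply/eqP/ffunP => i; have := bP i; rewrite /b !ffunE;
    case: (i \in S) => /andP[/eqP ? /eqP ?].
case: (boolP [forall i, b i]) => [/forallP bP|].
  by rewrite big1 // => i _; rewrite bP.
by rewrite negb_forall => /existsP[i /negbTE bi]; rewrite (bigD1 i) //= bi mul0r.
Qed.

(** Summing over [T] adds both projections at each site of [S], giving [q%:R * id_kernel]; sites
    outside [S] keep [trace_kernel]. *)
Lemma downsum_support_weight (S : {set 'I_n}) :
  downsum support_weight S = (q ^ #|S|)%:R * purity S.
Proof.
transitivity (\sum_(x : B) \sum_(y : B) \sum_(x' : B) \sum_(y' : B)
    psi x * (psi y)^* * (psi x' * (psi y')^*)^* *
    ((q ^ #|S|)%:R * ((y == merge S y' x)%:R * (x' == merge S x y')%:R))).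
  rewrite /downsum exchange_big; apply: eq_bigr => x _.
  rewrite exchange_big; apply: eq_bigr => y _.
  rewrite exchange_big; apply: eq_bigr => x' _.
  rewrite exchange_big; apply: eq_bigr => y' _.
  rewrite -prod_swap_kernel -mulr_sumr sum_prod_subset; congr (_ * _).
  by apply: eq_bigr => i _; rewrite /proj_kernel subrK.
rewrite mulr_sumr; apply: eq_bigr => x _.
under eq_bigr do rewrite exchange_big.
rewrite exchange_big mulr_sumr; apply: eq_bigr => y' _ /=.
rewrite (bigD1 (merge S y' x)) //= [X in _ + X]big1 ?addr0; last first.
  move=> y /negbTE yN; rewrite big1 // => x' _.
  by rewrite yN mul0r !mulr0.
rewrite (bigD1 (merge S x y')) //= big1 ?addr0; last first.
  by move=> x' /negbTE xN; rewrite xN !mulr0.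
by rewrite !eqxx !mulr1 !rmorphM /= conjCK; ring.
Qed.

End Purity.

(** * The rate condition and the asymptotics of the bound *)

(** That is, e <= 16/5, from ln (4/3) >= 1/4 and (4/3)^4 = 256/81 <= 16/5. *)
Lemma ln_16_5_ge1 (R : realType) : 1 <= ln (16 / 5 : R).
Proof.
have l34 : 1 / 4 <= ln (4 / 3 : R).
  have : ln (1 + - (1 / 4) : R) <= - (1 / 4) by apply: le_ln1Dx; lra.
  have -> : 1 + - (1 / 4) = (4 / 3)^-1 :> R by lra.
  by rewrite lnV ?posrE; lra.
have : ln ((4 / 3) ^+ 4 : R) <= ln (16 / 5).
  by rewrite ler_ln ?posrE; lra.
rewrite lnXn; last lra.
by lra.
Qed.

(* With d = 1 - 2 theta, the hypothesis reads
   d * (2 ln 2 + 2 ln q) < ln (1 + d) + d * ln (1 + 1/d).  If q^2 d >= 1, the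
   right side is at most d * (1 + ln (1 + q^2)), and e (1 + q^2) <= 4 q^2. *)
Lemma rate_below_plotkin (R : realType) (q : nat) (theta : R) :
  (2 <= q)%N -> theta < 1 / 2 ->
  0 < 1 / 2 * ln (1 - 2 * theta)
      + (1 - theta) * ln ((1 - theta) / (1 - 2 * theta))
      + theta * ln 2 - (1 - 2 * theta) * ln (q%:R) ->
  (1 - 2 * theta) * q%:R ^+ 2 < 1.
Proof.
move=> q2 th2 rate; rewrite ltNge; apply/negP => dQ.
move: rate; apply/negP; rewrite -leNgt.
have q2R : 2 <= q%:R :> R by rewrite (ler_nat R 2).
have q4R : 4 <= q%:R ^+ 2 :> R by nra.
have := @ln_16_5_ge1 R.
have -> : theta = (1 - (1 - 2 * theta)) / 2 by lra.
move: dQ; set d := 1 - 2 * theta => dQ ln165.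
have d_gt0 : 0 < d by rewrite /d; lra.
have -> : 1 - 2 * ((1 - d) / 2) = d by lra.
have -> : 1 - (1 - d) / 2 = (1 + d) / 2 by lra.
rewrite !ln_div ?posrE; try lra.
have l1 : ln (1 + d) <= d by apply: le_ln1Dx; lra.
have l2 : ln (1 + d) - ln d <= ln (1 + q%:R ^+ 2).
  rewrite -ln_div ?posrE; try lra.
  rewrite ler_ln ?posrE; [|apply: divr_gt0; lra|lra].
  by rewrite ler_pdivrMr //; nra.
(* Bounding 1 by ln (16/5) leaves 16/5 (1 + q^2) <= 4 q^2, which is q^2 >= 4, with equality at q =
   2. *)
have l3 : ln (1 + q%:R ^+ 2) + 1 <= ln 4 + ln (q%:R ^+ 2) :> R.
  rewrite -lnM ?posrE; try lra.
  apply: le_trans (lerD (lexx _) ln165) _.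
  rewrite -lnM ?posrE; try lra.
  rewrite ler_ln ?posrE; lra.
move: l3; have -> : 4 = 2 ^+ 2 :> R by lra.
rewrite !lnXn ?posrE; try lra.
move=> l3.
have l4 : d * (ln (1 + d) - ln d + 1) <= d * (2 * ln 2 + 2 * ln q%:R).
  by rewrite ler_pM2l //; lra.
lra.
Qed.

(** If k > theta n, then at s = n/2 + O(1) the second factor of the bound is linear in n, and a
    large enough constant power of q makes the left side exceed q^2 (k + 1). *)
Lemma plotkin_asymptotic (R : realType) (q : nat) (theta : R) :
  (2 <= q)%N -> (1 - 2 * theta) * q%:R ^+ 2 < 1 ->
  exists N : nat, forall n k : nat, (N <= n)%N -> (k <= n)%N ->
    (forall s : nat, (n <= s.*2)%N -> (s <= n)%N ->
      (q ^ (s.*2 - n) * (q ^ 2 * k.+1 - s * (q ^ 2 - 1)) <= q ^ 2 * k.+1)%N) ->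
    k%:R <= theta * n%:R.
Proof.
move=> q2 dQ.
have q2R : 2 <= q%:R :> R by rewrite (ler_nat R 2).
have q4R : 4 <= q%:R ^+ 2 :> R by nra.
set Q : R := q%:R ^+ 2 in dQ q4R.
(* This is [Q] times the excess of [theta] over (1 - 1/Q) / 2. *)
set eps := (1 - (1 - 2 * theta) * Q) / 2.
have eps_gt0 : 0 < eps by rewrite /eps; lra.
(* [u] makes the power of [q] at least 4 Q / eps; [M] then makes n eps / 2 absorb the error of order
   u Q from [s] exceeding n/2. *)
pose u := (Num.truncn (4 * Q / eps)).+1.
have uP : 4 * Q <= u%:R * eps.
  by rewrite -ler_pdivrMr //; apply/ltW/truncnS_gt.
pose M := (Num.truncn (2 * u%:R * Q / eps)).+1.
have MP : 2 * u%:R * Q <= M%:R * eps.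
  by rewrite -ler_pdivrMr //; apply/ltW/truncnS_gt.
exists (M + 2 * u + 2)%N => n k nN kn bound.
rewrite leNgt; apply/negP => kth.
set s := (uphalf n + u)%N.
have s1 : (n <= s.*2)%N by lia.
have s2 : (s <= n)%N by lia.
have := bound _ s1 s2; apply/negP; rewrite -ltnNge.
set X := (q ^ (s.*2 - n))%N; set b := (q ^ 2 * k.+1)%N.
set c := (s * (q ^ 2 - 1))%N.
have XP : 4 * Q <= X%:R * eps.
  apply: le_trans uP _; rewrite ler_pM2r // ler_nat.
  apply: leq_trans (ltnW (ltn_expl u (q2 : 1 < q)%N)) _.
  by rewrite leq_exp2l //; lia.
have bE : b%:R = Q * (k%:R + 1) :> R by rewrite /b natrM natrX -natr1.
have cE : c%:R = s%:R * (Q - 1) :> R.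
  by rewrite /c natrM natrB ?expn_gt0 ?natrX //; lia.
(* Truncated subtraction can only exceed the real difference. *)
have bc : b%:R - c%:R <= (b - c)%:R :> R.
  have [bc|/ltnW cb] := leqP b c; last by rewrite natrB.
  by apply: le_trans (ler0n _ _); rewrite subr_le0 ler_nat.
have sn : s%:R <= n%:R / 2 + u%:R + 1 :> R.
  suff : (s.*2)%:R <= (n + 2 * u + 2)%:R :> R.
    by rewrite -mul2n !natrM !natrD natrM; lra.
  by rewrite ler_nat; lia.
have nM : (M + 2)%:R <= n%:R :> R by rewrite ler_nat; lia.
have k_le : k%:R <= n%:R :> R by rewrite ler_nat.
have M_ge0 : 0 <= M%:R :> R by [].
have u_ge0 : 0 <= u%:R :> R by [].
rewrite natrD in nM.
rewrite -(ltr_nat R) natrM.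
have gap : n%:R * eps / 2 <= b%:R - c%:R.
  have : s%:R * (Q - 1) <= (n%:R / 2 + u%:R + 1) * (Q - 1).
    by rewrite ler_pM2r //; lra.
  have : Q * (theta * n%:R) <= Q * k%:R by rewrite ler_pM2l; lra.
  have : M%:R * eps <= n%:R * eps by rewrite ler_pM2r //; lra.
  rewrite bE cE => h1 h2 h3.
  have e : n%:R * eps = Q * (theta * n%:R) - n%:R / 2 * (Q - 1).
    by rewrite /eps; field.
  lra.
apply: lt_le_trans (ler_wpM2l (ler0n _ X) (le_trans gap bc)).
have -> : X%:R * (n%:R * eps / 2) = (X%:R * eps) * n%:R / 2 by field.
have : 4 * Q * n%:R <= X%:R * eps * n%:R by rewrite ler_wpM2r.
have : Q * (k%:R + 1) < Q * (2 * n%:R) by rewrite ltr_pM2l; lra.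
by rewrite bE; lra.
Qed.

(** * The bound for k-uniform states *)

Lemma k_uniform_plotkin (R : rcfType) (n q k : nat)
    (psi : {ffun 'I_n -> 'I_q} -> R[i]) :
  (0 < q)%N -> (k <= n)%N -> k_uniform k psi ->
  forall s : nat, (n <= s.*2)%N -> (s <= n)%N ->
  (q ^ (s.*2 - n) * (q ^ 2 * k.+1 - s * (q ^ 2 - 1)) <= q ^ 2 * k.+1)%N.
Proof.
move=> q_gt0 kn psik s; rewrite -[n in (n <= _)%N]card_ord => ns sn.
rewrite -[n in (_ - n)%N]card_ord.
apply: (@plotkin_bound _ _ (support_weight psi)) => //; try by rewrite card_ord.
- by move=> U; apply: support_weight_ge0.
- rewrite -downsum_set0 downsum_support_weight cards0 mul1r purity_set0 //.
  by case: psik.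
- move=> S Sk; rewrite downsum_support_weight (purity_k_uniform psik Sk) Sk.
  by rewrite divff // pnatr_eq0 -lt0n expn_gt0 q_gt0.
(* Duality: a pure state has equal purities on [S] and on its complement. *)
- by move=> S; rewrite !downsum_support_weight purity_setC mulrCA.
Qed.

Theorem theorem6 (R : realType) (q : nat) (theta : R) :
  (2 <= q)%N -> theta < 1 / 2 ->
  0 < 1 / 2 * ln (1 - 2 * theta)
      + (1 - theta) * ln ((1 - theta) / (1 - 2 * theta))
      + theta * ln 2 - (1 - 2 * theta) * ln (q%:R) ->
  exists N : nat, forall n k : nat, (N <= n)%N -> (k <= n)%N ->
    (exists psi : {ffun 'I_n -> 'I_q} -> R[i], k_uniform k psi) ->
    k%:R <= theta * n%:R.
Proof.
move=> q2 th2 rate.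
have [N bound] := plotkin_asymptotic q2 (rate_below_plotkin q2 th2 rate).
exists N => n k Nn kn [psi psik]; apply: (bound n k Nn kn).
exact: k_uniform_plotkin (ltnW q2) kn psik.
Qed.
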